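(* Let $\mathcal{P}^{(1)}$ be the set of discrete distributions $F$ with sizes $s=(s_1,\ldots,s_m)$ and probabilities $p=(p_1,\ldots,p_m)$ such that $p=\alpha b$ for some $\alpha>0$ and some perfect-packing configuration $b$ of $F$. Then \[ \frac23\ \le\ \inf_{F\in\mathcal{P}^{(1)}}\mathrm{AECR}(\mathrm{DNF},F)\ \le\ \left(\sum_{i=1}^\infty\frac{(i-1)!}{i^i}\right)^{-1}. \] Moreover, for every $F\in\mathcal{P}^{(1)}$ whose maximum item size is at least $\frac12$, \[ \mathrm{AECR}(\mathrm{DNF},F)\ \ge\ \left(1+\sum_{i=2}^\infty\frac{1}{i^2}\left(1-\frac1i\right)^{i-2}\right)^{-1}. \]
   Context: Bin covering: for a list $L$ of item sizes in $[0,1]$, a bin is covered if its total size is at least $1$; $\mathrm{OPT}(L)$ is the maximum number of pairwise disjoint sets of items of $L$ each of total size at least $1$. Dual Next-Fit ($\mathrm{DNF}$) processes the items in order, putting every item into a single current bin; as soon as the current bin has total size at least $1$ it is counted as covered and a new empty current bin is started; $\mathrm{DNF}(L)$ is the number of covered bins. A discrete distribution $F$ is given by non-negative rational item sizes $(s_1,\ldots,s_m)$ and positive rational probabilities $(p_1,\ldots,p_m)$ summing to $1$; $I_n(F)$ is a list of $n$ i.i.d. items drawn from $F$. A perfect-packing configuration of $F$ is a vector $b\in\mathbb{N}_0^m$ with $\sum_{i=1}^m b_i s_i=1$. $\mathrm{AECR}(\mathrm{DNF},F)=\liminf_{n\to\infty}\mathbb{E}[\mathrm{DNF}(I_n(F))]/\mathbb{E}[\mathrm{OPT}(I_n(F))]$.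 *)

(* Defs.v *)
From HB Require Import structures.
From mathcomp Require Export all_boot all_order all_algebra.
From mathcomp Require Export all_classical all_reals all_analysis.

Set Implicit Arguments.
Unset Strict Implicit.
Unset Printing Implicit Defensive.

Export Order.TTheory GRing.Theory Num.Theory.
Export numFieldNormedType.Exports.

Local Open Scope classical_set_scope.
Local Open Scope ring_scope.

(* Items are referred to by their position in L, so that repeated sizes count
   as different items. *)
Definition covering_family (L : seq rat) (P : {set {set 'I_(size L)}}) : bool :=
  finset.trivIset P && [forall B in P, 1 <= \sum_(i in B) L`_i].

Definition OPT (L : seq rat) : nat :=
  (\max_(P : {set {set 'I_(size L)}} | covering_family P) #|P|)%N.

(* [level] is the total size already in the current bin. *)
Fixpoint DNF_from (level : rat) (L : seq rat) : nat :=
  if L is x :: L' then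
    if 1 <= level + x then (DNF_from 0 L').+1 else DNF_from (level + x) L'
  else 0%N.

Definition DNF (L : seq rat) : nat := DNF_from 0 L.

Record discrete_dist := DiscreteDist {
  nitems : nat;
  isize : 'I_nitems -> rat;
  iprob : 'I_nitems -> rat;
  isize_range : forall i, 0 <= isize i <= 1;
  iprob_gt0 : forall i, 0 < iprob i;
  iprob_sum1 : \sum_i iprob i = 1 }.

(* E[f(I_n(F))]; a draw of n i.i.d. items is a word w over the item types,
   weighted by the product of the probabilities of its letters. *)
Definition expected (f : seq rat -> nat) (F : discrete_dist) (n : nat) : rat :=
  \sum_(w : n.-tuple 'I_(nitems F))
    (\prod_(i <- w) iprob i) * (f [seq isize i | i <- w])%:R.

(* For small n the denominator E[OPT] may vanish, and the quotient is then 0;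
   this does not affect the lower limit as soon as some list of items drawn
   from F covers a bin. *)
Definition AECR (R : realType) (alg : seq rat -> nat) (F : discrete_dist) :
    \bar R :=
  limn_einf (fun n => (ratr (expected alg F n / expected OPT F n))%:E).

Definition perfect_packing (F : discrete_dist) (b : 'I_(nitems F) -> nat) :
    Prop :=
  \sum_i (b i)%:R * isize i = 1.

Definition P1 : set discrete_dist :=
  [set F | exists (alpha : rat) (b : 'I_(nitems F) -> nat),
      [/\ 0 < alpha, perfect_packing b
        & forall i, iprob i = alpha * (b i)%:R]].

Definition max_isize (F : discrete_dist) : rat :=
  \big[Num.max/0]_(i < nitems F) isize i.

(* Main.v *)
(* Drawing from F in P1 is drawing uniformly from a list of B items of total
   size 1. If tau is the number of draws needed to fill a bin, DNF covers about
   n / E[tau] bins and the optimum at most n / B of them, so that the ratio is at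
   least B / E[tau].

   If all items have size at most 1/2, Wald's identity gives E[tau] <= 3B/2. If
   one item has size y >= 1/2, a bin that is not yet filled contains it at most
   once, and if it does, its other items have total size less than 1 - y, which
   is the total size of the other N = B - 1 items of the list. Hence
   E[tau] <= B (1 + E[phi(tau')]) with tau' the time needed to reach total size
   1 - y with those N items, and phi(k) the probability of at least two
   successes in k + 1 trials with success probability 1/B. The bound
   phi(k) <= (3/10) k/N and induction on B give
   E[tau] <= (1 + (3/10)(3/2)) B = (29/20) B, and 29/20 is less than the series
   of the theorem.

   For the upper bound take B equally likely items of rapidly decreasing sizes.
   A bin remains unfilled as long as, for some j, items 1, ..., j - 1 have each
   been drawn exactly once and item j has not been drawn; these events are
   disjoint and the j-th one lasts B (j-1)!/j^j draws on average. The optimum is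
   asymptotically n / B, by Chebyshev's inequality for the item counts. *)
Require Import Defs.
From mathcomp Require Import ring lra zify.

Set Implicit Arguments.
Unset Strict Implicit.
Unset Printing Implicit Defensive.

Local Open Scope classical_set_scope.
Local Open Scope ring_scope.

(** * A bound on a negative binomial tail *)

Lemma expR_partial_le (R : realType) (s : R) K : 0 <= s ->
  \sum_(0 <= n < K) exp_coeff s n <= expR s.
Proof.
move=> s0; apply: (nondecreasing_cvgn_le (u_ := series (exp_coeff s))).
  apply/nondecreasing_seqP => n; rewrite /series/= big_nat_recr//= lerDl.
  exact: exp_coeff_ge0.
exact: is_cvg_series_exp_coeff.
Qed.

(** As [s * expR s] has the series of [n%:R * exp_coeff s n], the left side is the full series whose
    first K terms stand on the right. From index K on the terms are non-positive. *)
Lemma expR_mulB_le (R : realType) (c s : R) K : 0 <= s -> 1 <= c * K%:R ->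
  expR s * (1 - c * s) <= \sum_(0 <= n < K) exp_coeff s n * (1 - c * n%:R).
Proof.
move=> s0 cK.
have c0 : 0 <= c.
  rewrite leNgt; apply/negP => c0.
  have : c * K%:R <= 0 by rewrite mulr_le0_ge0// ltW.
  by lra.
have mulE n : \sum_(0 <= i < n.+1) exp_coeff s i * (1 - c * s) =
    \sum_(0 <= i < n.+1) exp_coeff s i * (1 - c * i%:R)
      - c * s * exp_coeff s n.
  elim: n => [|n IH]; first by rewrite !big_nat1 /exp_coeff/=; ring.
  rewrite big_nat_recr//= IH (big_nat_recr n.+1)//=.
  suff : c * (exp_coeff s n.+1 * n.+1%:R) = c * (s * exp_coeff s n) by lra.
  congr (c * _).
  rewrite /exp_coeff/= exprS factS natrM.
  have := ltr0Sn R n; have : 0 < n`!%:R :> R by rewrite ltr0n fact_gt0.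
  by move=> f0 n0; field; rewrite !gt_eqF.
have cvg_s : (fun n => series (exp_coeff s) n.+1 * (1 - c * s)) @ \oo -->
    expR s * (1 - c * s).
  apply: cvgMr_tmp; rewrite (cvg_shiftS (series (exp_coeff s))).
  exact: is_cvg_series_exp_coeff.
apply: (ler_cvg_to cvg_s (cvg_cst _)).
near=> n.
rewrite /series/= mulr_suml mulE.
have Kn : (K <= n.+1)%N by near: n; exists K => // m /= /leq_trans; apply.
rewrite (big_cat_nat (leq0n K) Kn)/=.
have : 0 <= c * s * exp_coeff s n.
  exact: mulr_ge0 (mulr_ge0 c0 s0) (exp_coeff_ge0 n s0).
have : \sum_(K <= i < n.+1) exp_coeff s i * (1 - c * i%:R) <= 0.
  rewrite big_nat_cond sumr_le0// => i /andP[/andP[Ki _] _].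
  apply: mulr_ge0_le0; first exact: exp_coeff_ge0.
  have : K%:R <= i%:R :> R by rewrite ler_nat.
  by nra.
by lra.
Unshelve. all: by end_near.
Qed.

Lemma expR_mulB3 (R : realType) (s : R) : 0 <= s ->
  expR s * (1 - 3 / 10 * s) <= 1 + s.
Proof.
move=> s0.
(* Four terms already meet the condition on K; the negative terms of index 4 to 7 sharpen the
   bound. *)
apply: (@le_trans _ _ (\sum_(0 <= n < 8) exp_coeff s n * (1 - 3 / 10 * n%:R))).
  by apply: expR_mulB_le => //; lra.
rewrite !big_nat_recr//= big_nil /exp_coeff/= !factS fact0.
(* The inequality is tightest near s = 9/5. *)
have sq (i : nat) : 0 <= s ^+ i.+1 * (s - 9 / 5) ^+ 2.
  exact: mulr_ge0 (exprn_ge0 _ s0) (sqr_ge0 _).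
move: (sq 0%N) (sq 1%N) (sq 2%N) (sq 3%N) (sq 4%N) (exprn_ge0 2 s0).
by move=> *; lra.
Qed.

Lemma expR_mulB4 (R : realType) (s : R) : 0 <= s ->
  expR s * (1 - 4 / 10 * s) <= 1 + 2 / 3 * s.
Proof.
move=> s0.
apply: (@le_trans _ _ (\sum_(0 <= n < 6) exp_coeff s n * (1 - 4 / 10 * n%:R))).
  by apply: expR_mulB_le => //; lra.
rewrite !big_nat_recr//= big_nil /exp_coeff/= !factS fact0.
(* The difference of the two sides, divided by s, is smallest near s = 3/4. *)
have sq (i : nat) : 0 <= s ^+ i.+1 * (s - 3 / 4) ^+ 2.
  exact: mulr_ge0 (exprn_ge0 _ s0) (sqr_ge0 _).
move: (sq 0%N) (sq 1%N) (sq 2%N) (exprn_ge0 2 s0).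
by move=> *; lra.
Qed.

Lemma expR_ge1Dx2 (R : realType) (x : R) : 0 <= x -> 1 + x + x ^+ 2 / 2 <= expR x.
Proof.
move=> x0; apply: le_trans (expR_partial_le 3 x0).
rewrite !big_nat_recr//= big_nil /exp_coeff/= !factS fact0.
by rewrite !muln1 expr0 expr1 !divr1 add0r.
Qed.

Lemma expR1_le (R : realType) : expR 1 <= 11 / 4 :> R.
Proof.
have : expR 1 * (1 - 3 / 10 * 1) <= _ := @expR_mulB_le R (3 / 10) 1 4 ler01 _.
rewrite !big_nat_recr//= big_nil /exp_coeff/= !factS fact0 !expr1n.
by move=> /(_ ltac:(lra)); lra.
Qed.

(* With s the mean of k/N and k/(N+1), the left-hand side is affine in
   1/(2N+1), which lies between 0 and 1/3. *)
Lemma negbin_tail_le (R : realType) (N k : nat) : (0 < N)%N ->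
  1 - (N%:R / N.+1%:R) ^+ k * (1 + k%:R / N.+1%:R) <= 3 / 10 * (k%:R / N%:R) :> R.
Proof.
move=> N0; have n0 : 0 < N%:R :> R by rewrite ltr0n.
have n1 : 1 <= N%:R :> R by rewrite ler1n.
rewrite -natr1; set n : R := N%:R in n0 n1 *.
have k0 : 0 <= k%:R :> R by [].
pose x : R := (2 * n + 1) / (2 * n * (n + 1)).
have x0 : 0 <= x by rewrite divr_ge0 ?mulr_ge0//; lra.
pose s : R := k%:R * x.
have s0 : 0 <= s by rewrite mulr_ge0.
(* Here x is the mean of 1/n and 1/(n+1), and already 1 + x + x^2/2 exceeds 1 + 1/n. *)
have qx : expR (- x) <= n / (n + 1).
  rewrite expRN -[leRHS]invrK lef_pV2 ?posrE ?expR_gt0 ?invr_gt0 ?divr_gt0//; last lra.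
  apply: le_trans (expR_ge1Dx2 x0).
  rewrite -subr_ge0 [leRHS](_ : _ = ((2 * n + 1) ^+ 2 - 4 * n * (n + 1)) /
    (8 * n ^+ 2 * (n + 1) ^+ 2)).
    by rewrite divr_ge0 ?mulr_ge0 ?exprn_ge0//; nra.
  by rewrite /x; field; rewrite !gt_eqF//; lra.
have qk : expR (- s) <= (n / (n + 1)) ^+ k.
  rewrite -mulrN expRM_natl; apply: lerXn2r => //; rewrite nnegrE ?expR_ge0//.
  exact: le_trans (expR_ge0 _) qx.
pose d : R := (2 * n + 1)^-1.
have d0 : 0 <= d by rewrite invr_ge0; lra.
have d3 : d <= 1 / 3 by rewrite /d -(invrK (1 / 3)) lef_pV2 ?posrE; lra.
have -> : k%:R / (n + 1) = s * (1 - d).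
  by rewrite /s /x /d; field; rewrite !gt_eqF//; lra.
have -> : k%:R / n = s * (1 + d).
  by rewrite /s /x /d; field; rewrite !gt_eqF//; lra.
have e0 := expR_gt0 (- s).
(* [B3] and [B4] are the endpoint cases d = 0 and d = 1/3; the weights 1 - 3d and 3d interpolate
   between them. *)
have B3 : 1 - 3 / 10 * s <= expR (- s) * (1 + s).
  by rewrite expRN ler_pdivlMl ?expR_gt0// expR_mulB3.
have B4 : 1 - 4 / 10 * s <= expR (- s) * (1 + 2 / 3 * s).
  by rewrite expRN ler_pdivlMl ?expR_gt0// expR_mulB4.
have : expR (- s) * (1 + s * (1 - d)) <= (n / (n + 1)) ^+ k * (1 + s * (1 - d)).
  by rewrite ler_wpM2r// addr_ge0// mulr_ge0//; lra.
have : 0 <= (1 - 3 * d) * (expR (- s) * (1 + s) - (1 - 3 / 10 * s)).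
  by rewrite mulr_ge0//; lra.
have : 0 <= 3 * d * (expR (- s) * (1 + 2 / 3 * s) - (1 - 4 / 10 * s)).
  by rewrite !mulr_ge0//; lra.
by lra.
Qed.

(** With success probability 1/(N+1), term m is the probability that the second success comes at
    trial m + 2. The right side is the probability of at least two successes in k + 1 trials. *)
Lemma negbin_sumE (F : numFieldType) (N k : nat) :
  \sum_(m < k) m.+1%:R * (N%:R / N.+1%:R) ^+ m / N.+1%:R ^+ 2 =
    1 - (N%:R / N.+1%:R) ^+ k * (1 + k%:R / N.+1%:R) :> F.
Proof.
have n0 : N%:R + 1 != 0 :> F by rewrite natr1 pnatr_eq0.
elim: k => [|k IH]; first by rewrite big_ord0; field.
rewrite big_ord_recr/= IH [_ ^+ k.+1]exprS; set Q := _ ^+ k.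
by rewrite -!natr1; field.
Qed.

(** Both sides are rational, so the bound obtained with the real exponential descends along
    [ratr]. *)
Lemma negbin_sum_le (R : realType) (N k : nat) : (0 < N)%N ->
  \sum_(m < k) m.+1%:R * (N%:R / N.+1%:R) ^+ m / N.+1%:R ^+ 2
    <= 3 / 10 * (k%:R / N%:R) :> rat.
Proof.
move=> N0; rewrite negbin_sumE -(ler_rat R).
rewrite !(rmorphM, rmorphB, rmorphXn, fmorphV) rmorphD rmorph1 !rmorphM !fmorphV.
by rewrite !rmorph_nat; exact: negbin_tail_le.
Qed.

(** Summation by parts. The induction carries the slack of the M-th prefix sum, weighted by [p M],
    as a boundary term. *)
Lemma abel_sum_le (F : numDomainType) (w p : nat -> F) (c : F) M :
  (forall k, \sum_(m < k) w m <= c * k%:R) ->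
  (forall m, 0 <= p m.+1 <= p m) ->
  \sum_(m < M) w m * p m <= c * \sum_(m < M) p m.
Proof.
move=> wc pd.
suff : (c * M%:R - \sum_(m < M) w m) * p M <=
    c * (\sum_(m < M) p m) - \sum_(m < M) w m * p m.
  move=> H; rewrite -subr_ge0; apply: le_trans H.
  rewrite mulr_ge0 ?subr_ge0//.
  have /andP[p1 p2] := pd M; exact: le_trans p1 p2.
elim: M => [|M IH]; first by rewrite !big_ord0 !mulr0 subrr mul0r.
have /andP[_ pM] := pd M; have d0 : 0 <= c * M.+1%:R - \sum_(m < M.+1) w m by rewrite subr_ge0.
apply: le_trans (ler_wpM2l d0 pM) _.
rewrite -subr_ge0 in IH; rewrite !big_ord_recr/= -natr1 -subr_ge0.
by apply: le_trans IH _; rewrite le_eqVlt; apply/orP; left; apply/eqP; ring.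
Qed.

(** * The time needed to fill a bin *)

Definition mean (s : seq rat) (f : rat -> rat) : rat :=
  (\sum_(x <- s) f x) / (size s)%:R.

Lemma mulr_mean s f : (size s)%:R * mean s f = \sum_(x <- s) f x.
Proof.
rewrite /mean; case: s => [|a s]; first by rewrite !big_nil mul0r ?mulr0.
by rewrite mulrC divfK// pnatr_eq0.
Qed.

Lemma ler_mean s f g : (forall x, x \in s -> f x <= g x) -> mean s f <= mean s g.
Proof.
move=> fg; rewrite ler_wpM2r ?invr_ge0//.
by rewrite big_seq [leRHS]big_seq; apply: ler_sum.
Qed.

Lemma mean_ge0 s f : (forall x, x \in s -> 0 <= f x) -> 0 <= mean s f.
Proof. by move=> f0; rewrite mulr_ge0 ?invr_ge0// big_seq sumr_ge0. Qed.

Lemma mean_cst s c : (0 < size s)%N -> mean s (fun=> c) = c.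
Proof.
move=> s0; rewrite /mean big_const_seq count_predT iter_addr_0.
by rewrite -[c *+ _]mulr_natr mulfK// pnatr_eq0 -lt0n.
Qed.

Lemma mean_sum (I : finType) s (f : I -> rat -> rat) :
  mean s (fun x => \sum_i f i x) = \sum_i mean s (f i).
Proof. by rewrite /mean exchange_big/= mulr_suml. Qed.

Lemma meanZ s c f : mean s (fun x => c * f x) = c * mean s f.
Proof. by rewrite /mean -mulr_sumr mulrA. Qed.

Lemma meanD s f g : mean s (fun x => f x + g x) = mean s f + mean s g.
Proof. by rewrite /mean big_split/= mulrDl. Qed.

Lemma mean_cons y s f :
  mean (y :: s) f = f y / (size s).+1%:R +
    (size s)%:R / (size s).+1%:R * mean s f.
Proof.
by rewrite mulrAC mulr_mean /mean big_cons/= mulrDl.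
Qed.

Lemma perm_mean s s' f : perm_eq s s' -> mean s f = mean s' f.
Proof. by move=> ss'; rewrite /mean (perm_big _ ss') (perm_size ss'). Qed.

(* The probability that t uniform draws with replacement from s have total
   size less than r. *)
Fixpoint below (s : seq rat) (t : nat) (r : rat) : rat :=
  if t is t'.+1 then mean s (fun x => below s t' (r - x)) else (0 < r)%R%:R.

Lemma below_ge0 s t r : 0 <= below s t r.
Proof. by elim: t r => [|t IH] r /=; [|apply: mean_ge0]. Qed.

Lemma ler_below s t r r' : r <= r' -> below s t r <= below s t r'.
Proof.
elim: t r r' => [|t IH] r r' rr' /=.
  by rewrite ler_nat; case: ltP => // /lt_le_trans ->.
by apply: ler_mean => x _; apply: IH; rewrite lerD2r.
Qed.

Lemma perm_below s s' t r : perm_eq s s' -> below s t r = below s' t r.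
Proof.
move=> ss'; elim: t r => //= t IH r.
by rewrite (perm_mean _ ss') /mean; under eq_bigr do rewrite IH.
Qed.

Section Nonneg.
Variable s : seq rat.
Hypothesis s_ge0 : forall x, x \in s -> 0 <= x.

Lemma below_npos t r : r <= 0 -> below s t r = 0.
Proof.
elim: t r => [|t IH] r r0 /=; first by rewrite ltNge r0.
rewrite /mean big_seq big1 ?mul0r// => x xs; apply: IH.
by have := s_ge0 xs; lra.
Qed.

Lemma below_noninc t r : below s t.+1 r <= below s t r.
Proof.
have sub x t' r' : x \in s -> below s t' (r' - x) <= below s t' r'.
  by move=> /s_ge0 x0; apply: ler_below; lra.
case: (posnP (size s)) => [s0|s0].
  by rewrite /= /mean s0 invr0 mulr0 below_ge0.
by rewrite -[leRHS](mean_cst _ s0)/=; apply: ler_mean => x /sub.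
Qed.

End Nonneg.

(* The expected value of min(tau, M), where tau is the number of draws from s
   needed to reach total size r. *)
Definition trunc_time (s : seq rat) (M : nat) (r : rat) : rat :=
  \sum_(t < M) below s t r.

Lemma trunc_timeS s M r :
  trunc_time s M.+1 r = (0 < r)%R%:R + mean s (fun x => trunc_time s M (r - x)).
Proof. by rewrite /trunc_time big_ord_recl mean_sum. Qed.

Lemma trunc_time_npos s M r : (forall x, x \in s -> 0 <= x) -> r <= 0 ->
  trunc_time s M r = 0.
Proof. by move=> s0 r0; rewrite /trunc_time big1// => i _; apply: below_npos. Qed.

Lemma perm_trunc_time s s' M r :
  perm_eq s s' -> trunc_time s M r = trunc_time s' M r.
Proof. by move=> ss'; apply: eq_bigr => t _; apply: perm_below. Qed.

(* Wald's identity: a filled bin has level at most r + m. *)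
Lemma trunc_time_wald s m M r :
  (forall x, x \in s -> 0 <= x <= m) -> 0 <= r + m ->
  (\sum_(x <- s) x) * trunc_time s M r <= (size s)%:R * (r + m).
Proof.
move=> sm; elim: M r => [|M IH] r rm.
  by rewrite /trunc_time big_ord0 mulr0 mulr_ge0.
have [r0|r0] := lerP r 0.
  by rewrite trunc_time_npos ?mulr0 ?mulr_ge0// => x /sm /andP[].
rewrite trunc_timeS r0 mulrDr mulr1 -meanZ.
case: (posnP (size s)) => [s0|s0].
  by rewrite (size0nil s0) /mean !big_nil !mul0r addr0.
apply: (@le_trans _ _ (\sum_(x <- s) x +
    mean s (fun x => (size s)%:R * (r + m) + - (size s)%:R * x))).
  (* The last draw may overshoot by up to m, so the induction must admit negative targets down to
     -m. *)
  rewrite lerD2l; apply: ler_mean => x /sm/andP[x0 xm].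
  by rewrite mulNr -mulrBr addrAC IH//; lra.
by rewrite meanD mean_cst// meanZ mulNr mulr_mean; lra.
Qed.

(** * Lists with one item of at least half the total size *)

Section BigItem.
Variables (y : rat) (s : seq rat).
Hypothesis y_ge0 : 0 <= y.
Hypothesis s_ge0 : forall x, x \in s -> 0 <= x.
Let N : rat := (size s)%:R.
Let B : rat := (size s).+1%:R.

Let ys_ge0 x : x \in y :: s -> 0 <= x.
Proof. by rewrite in_cons => /predU1P[->|/s_ge0]. Qed.

(** A single y reaches the target, so all t draws must avoid it; given that, they are uniform on
    s. *)
Lemma below_big1 t r : r <= y ->
  below (y :: s) t r <= (N / B) ^+ t * below s t r.
Proof.
elim: t r => [|t IH] r ry; first by rewrite expr0 mul1r.
rewrite /= mean_cons below_npos//; last by lra.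
rewrite mul0r add0r exprS -[N / B * _ * _]mulrA ler_wpM2l ?divr_ge0// -meanZ.
by apply: ler_mean => x /s_ge0 x0; apply: IH; lra.
Qed.

(** Two copies of y reach the target. The summands account for no copy, and for one copy at any of
    the t positions while the other draws stay below r - y. *)
Lemma below_big2 t r : r <= 2 * y ->
  below (y :: s) t r <=
    (N / B) ^+ t + t%:R * (N / B) ^+ t.-1 / B * below s t.-1 (r - y).
Proof.
have NB0 : 0 <= N / B by rewrite divr_ge0.
elim: t r => [|t IH] r ry; first by rewrite expr0 !mul0r addr0 lern1 leq_b1.
rewrite [t.+1.-1]/=.
have -> : below (y :: s) t.+1 r = below (y :: s) t (r - y) / B +
    N / B * mean s (fun x => below (y :: s) t (r - x)) by exact: mean_cons.
have : below (y :: s) t (r - y) / B <= (N / B) ^+ t * below s t (r - y) / B.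
  by rewrite ler_wpM2r ?invr_ge0// below_big1//; lra.
suff : mean s (fun x => below (y :: s) t (r - x)) * (N / B) <=
    (N / B) ^+ t.+1 + t%:R * (N / B) ^+ t / B * below s t (r - y).
  rewrite -[t.+1%:R]natr1 => H1 H2; rewrite (mulrC (N / B)) addrC.
  by apply: le_trans (lerD H1 H2) _; rewrite le_eqVlt; apply/orP; left; apply/eqP; ring.
have [s0|s0] := posnP (size s).
  rewrite /N s0 mul0r mulr0 addr_ge0 ?exprn_ge0//.
  by rewrite !mulr_ge0 ?exprn_ge0 ?invr_ge0// below_ge0.
apply: (@le_trans _ _ (mean s (fun x => (N / B) ^+ t +
    t%:R * (N / B) ^+ t.-1 / B * below s t.-1 (r - y - x)) * (N / B))).
  rewrite ler_wpM2r//; apply: ler_mean => x /s_ge0 x0.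
  by rewrite (_ : r - y - x = r - x - y) ?IH//; lra.
rewrite meanD mean_cst// meanZ mulrDl -exprSr lerD2l.
case: t {IH} => [|t]; first by rewrite !mul0r.
by rewrite /= exprSr le_eqVlt; apply/orP; left; apply/eqP; ring.
Qed.

(** Summing [below_big2] over t, the terms without y form a geometric series of value at most B.
    Those with one y are B times second-success probabilities weighted by the non-increasing
    [below s m z], so [abel_sum_le] applies. *)
Lemma trunc_time_big (R : realType) C M : \sum_(x <- s) x <= y ->
  trunc_time s M (\sum_(x <- s) x) <= C * N -> 0 <= C ->
  trunc_time (y :: s) M (y + \sum_(x <- s) x) <= (1 + 3 / 10 * C) * B.
Proof.
set z := \sum_(x <- s) x => zy totC C0.
have B0 : 0 < B by rewrite ltr0n.
have NB0 : 0 <= N / B by rewrite divr_ge0.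
have NB : N + 1 = B by rewrite /N /B natr1.
apply: (@le_trans _ _ (\sum_(t < M) ((N / B) ^+ t +
    t%:R * (N / B) ^+ t.-1 / B * below s t.-1 z))).
  apply: ler_sum => t _.
  by rewrite [z in leRHS](_ : z = y + z - y) ?below_big2//; lra.
rewrite big_split/= mulrDl mul1r lerD//.
  have := subrX1 (N / B) M.
  have -> : N / B - 1 = - B^-1 by rewrite -NB; field; rewrite NB gt_eqF.
  have := exprn_ge0 M NB0 => qM E.
  have -> : \sum_(i < M) (N / B) ^+ i = (1 - (N / B) ^+ M) * B.
    by rewrite -[1 - _]opprB E; field; rewrite gt_eqF.
  by rewrite ler_piMl//; lra.
have c0 : 0 <= 3 / 10 :> rat by [].
have CB0 : 0 <= 3 / 10 * C * B.
  exact: mulr_ge0 (mulr_ge0 c0 C0) (ltW B0).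
case: M totC => [|M] totC; first by rewrite big_ord0.
rewrite big_ord_recl !mul0r add0r /=.
have [s0|s0] := posnP (size s).
  have -> : z = 0 by rewrite /z (size0nil s0) big_nil.
  by rewrite big1 // => i _; rewrite below_npos ?mulr0.
have N0 : 0 < N by rewrite ltr0n.
have := @abel_sum_le rat (fun m => m.+1%:R * (N / B) ^+ m / B ^+ 2)
  (fun m => below s m z) (3 / 10 / N) M.
have w k : \sum_(m < k) m.+1%:R * (N / B) ^+ m / B ^+ 2 <= 3 / 10 / N * k%:R.
  by rewrite -mulrA [_^-1 * _]mulrC; exact: negbin_sum_le.
move=> /(_ w); have p m : 0 <= below s m.+1 z <= below s m z.
  by rewrite below_ge0 below_noninc.
move=> /(_ p) A.
have T : \sum_(m < M) below s m z <= C * N.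
  apply: le_trans totC; rewrite /trunc_time big_ord_recr/= lerDl below_ge0//.
have -> : \sum_(i < M) (i.+1)%:R * (N / B) ^+ i / B * below s i z =
    B * \sum_(m < M) (m.+1%:R * (N / B) ^+ m / B ^+ 2) * below s m z.
  by rewrite mulr_sumr; apply: eq_bigr => i _; field; rewrite gt_eqF.
rewrite mulrC ler_wpM2r ?(ltW B0)//; apply: le_trans A _.
rewrite mulrAC -[leLHS]mulrA ler_wpM2l// ler_pdivrMr//.
Qed.

End BigItem.

Lemma trunc_time_le (R : realType) s M : (forall x, x \in s -> 0 <= x) ->
  trunc_time s M (\sum_(x <- s) x) <= 3 / 2 * (size s)%:R.
Proof.
have [n] := ubnP (size s); elim: n s M => // n IH s M sn s0.
(* If some item is at least half the total, induction on the rest gives the factor 29/20 <= 3/2.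
   Otherwise Wald's bound with m = z/2 gives 3/2 directly. *)
have [/hasP[y ys zy]|/hasPn big] := boolP (has (fun y => \sum_(x <- s) x <= 2 * y) s).
  have p := perm_to_rem ys.
  rewrite (perm_trunc_time _ _ p) (perm_size p) (perm_big _ p) big_cons /=.
  have r0 x : x \in rem y s -> 0 <= x by move=> /mem_rem/s0.
  apply: (@le_trans _ _ ((1 + 3 / 10 * (3 / 2)) * (size (rem y s)).+1%:R)); last first.
    have c1 : 1 + 3 / 10 * (3 / 2) <= 3 / 2 :> rat by lra.
    by rewrite ler_wpM2r ?ler0n ?c1.
  have c0 : 0 <= 3 / 2 :> rat by lra.
  apply: (trunc_time_big (s0 y ys) r0 R _ _ c0).
    by move: zy; rewrite (perm_big _ p) big_cons/=; lra.
  by apply: IH r0; move: sn; rewrite (perm_size p)/=; lia.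
set z := \sum_(x <- s) x in big *.
have [z0|z0] := lerP z 0; first by rewrite trunc_time_npos// mulr_ge0.
have := @trunc_time_wald s (z / 2) M z; rewrite -/z => W.
rewrite -(ler_pM2l z0); apply: le_trans (W _ _) _; [|lra|lra].
by move=> x xs; rewrite s0//=; have := big x xs; rewrite -ltNge; lra.
Qed.

Lemma trunc_time_le_big (R : realType) s y M : (forall x, x \in s -> 0 <= x) ->
  y \in s -> \sum_(x <- s) x <= 2 * y ->
  trunc_time s M (\sum_(x <- s) x) <= 29 / 20 * (size s)%:R.
Proof.
move=> s0 ys zy; have p := perm_to_rem ys.
rewrite (perm_trunc_time _ _ p) (perm_size p) (perm_big _ p) big_cons /=.
have r0 x : x \in rem y s -> 0 <= x by move=> /mem_rem/s0.
rewrite (_ : 29 / 20 = 1 + 3 / 10 * (3 / 2)); last by lra.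
have c0 : 0 <= 3 / 2 :> rat by lra.
apply: (trunc_time_big (s0 y ys) r0 R _ _ c0).
  by move: zy; rewrite (perm_big _ p) big_cons/=; lra.
exact: trunc_time_le R _ _ r0.
Qed.

(** * Expected values of DNF and OPT *)

(* The expected value of f over words of n i.i.d. letters of law p. *)
Fixpoint Ex (m : nat) (p : 'I_m -> rat) (n : nat) (f : seq 'I_m -> rat) : rat :=
  if n is n'.+1 then \sum_i p i * Ex p n' (fun w => f (i :: w)) else f [::].

Lemma ExS m p n (f : seq 'I_m -> rat) :
  Ex p n.+1 f = \sum_i p i * Ex p n (fun w => f (i :: w)).
Proof. by []. Qed.

Section Draws.
Variables (m : nat) (p : 'I_m -> rat).
Hypothesis p_ge0 : forall i, 0 <= p i.
Hypothesis p_sum1 : \sum_i p i = 1.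

Implicit Types f g : seq 'I_m -> rat.

Lemma Ex_tuple n f :
  \sum_(w : n.-tuple 'I_m) (\prod_(i <- w) p i) * f w = Ex p n f.
Proof.
elim: n f => [|n IH] f /=.
  rewrite (big_pred1 [tuple]) /= ?big_nil ?mul1r// => w.
  by rewrite [w]tuple0; apply/esym/eqP; exact: val_inj.
rewrite [RHS](eq_bigr (fun i => \sum_(w : n.-tuple 'I_m)
    p i * ((\prod_(j <- w) p j) * f (i :: w)))); last first.
  by move=> i _; rewrite -IH mulr_sumr.
rewrite pair_big/=.
rewrite (reindex (fun u : 'I_m * n.-tuple 'I_m => [tuple of u.1 :: u.2]))/=.
  by apply: eq_bigr => u _; rewrite big_cons mulrA.
exists (fun w : n.+1.-tuple 'I_m => (thead w, [tuple of behead w])) => [[i w] _|w _] /=.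
  by congr (_, _); apply/val_inj.
by rewrite [RHS]tuple_eta; apply/val_inj.
Qed.

Lemma eq_Ex n f g : (forall w, size w = n -> f w = g w) -> Ex p n f = Ex p n g.
Proof.
elim: n f g => [|n IH] f g fg /=; first exact: fg.
by apply: eq_bigr => i _; congr (_ * _); apply: IH => w sw; apply: fg; rewrite /= sw.
Qed.

Lemma ler_Ex n f g : (forall w, size w = n -> f w <= g w) -> Ex p n f <= Ex p n g.
Proof.
elim: n f g => [|n IH] f g fg /=; first exact: fg.
apply: ler_sum => i _; rewrite ler_wpM2l// IH// => w sw.
by apply: fg; rewrite /= sw.
Qed.

Lemma ExD n f g : Ex p n (fun w => f w + g w) = Ex p n f + Ex p n g.
Proof.
elim: n f g => [|n IH] f g //=.
by rewrite -big_split/=; apply: eq_bigr => i _; rewrite IH mulrDr.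
Qed.

Lemma ExZ n c f : Ex p n (fun w => c * f w) = c * Ex p n f.
Proof.
elim: n f => [|n IH] f //=.
by rewrite mulr_sumr; apply: eq_bigr => i _; rewrite IH mulrCA.
Qed.

Lemma Ex_cst n c : Ex p n (fun=> c) = c.
Proof. by elim: n => //= n IH; rewrite -mulr_suml p_sum1 mul1r. Qed.

Lemma Ex_subl n c f : Ex p n (fun w => c - f w) = c - Ex p n f.
Proof.
rewrite -[X in X - _](Ex_cst n) -mulN1r -ExZ -ExD.
by apply: eq_Ex => w _; rewrite mulN1r.
Qed.

Lemma Ex_sum (I : Type) (r : seq I) (P : pred I) n (h : I -> seq 'I_m -> rat) :
  Ex p n (fun w => \sum_(j <- r | P j) h j w) = \sum_(j <- r | P j) Ex p n (h j).
Proof.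
elim: r => [|j r IH].
  by rewrite big_nil -[RHS](Ex_cst n); apply: eq_Ex => w _; rewrite big_nil.
rewrite big_cons; case: ifP => Pj; last first.
  by rewrite -IH; apply: eq_Ex => w _; rewrite big_cons Pj.
by rewrite -IH -ExD; apply: eq_Ex => w _; rewrite big_cons Pj.
Qed.

Lemma Ex_sum_letters n (h : 'I_m -> rat) :
  Ex p n (fun w => \sum_(i <- w) h i) = n%:R * \sum_i p i * h i.
Proof.
elim: n => [|n IH] /=; first by rewrite big_nil mul0r.
rewrite -natr1 mulrDl mul1r -IH.
under eq_bigr => i _.
  rewrite (@eq_Ex n _ (fun w => h i + \sum_(j <- w) h j)); last first.
    by move=> w _; rewrite big_cons.
  rewrite ExD Ex_cst mulrDr; over.
by rewrite big_split/= -mulr_suml p_sum1 mul1r addrC.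
Qed.

(** Cross terms vanish because h is centred, so variances add. The offset a absorbs the letters
    already read in the induction. *)
Lemma Ex_sqr n (h : 'I_m -> rat) (a : rat) : \sum_i p i * h i = 0 ->
  Ex p n (fun w => (a + \sum_(i <- w) h i) ^+ 2) =
    a ^+ 2 + n%:R * \sum_i p i * h i ^+ 2.
Proof.
move=> h0; elim: n a => [|n IH] a /=; first by rewrite big_nil mul0r !addr0.
under eq_bigr => i _.
  rewrite (@eq_Ex n _ (fun w => (a + h i + \sum_(j <- w) h j) ^+ 2)); last first.
    by move=> w _; rewrite big_cons addrA.
  rewrite IH (_ : _ * _ = p i * (a ^+ 2 + n%:R * \sum_i p i * h i ^+ 2) +
     2 * a * (p i * h i) + p i * h i ^+ 2); last by ring.
  over.
rewrite !big_split/= -mulr_suml p_sum1 -mulr_sumr h0 mulr0 addr0 mul1r -natr1.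
by ring.
Qed.

End Draws.

Lemma expectedE f F n :
  expected f F n = Ex (@iprob F) n (fun w => (f [seq isize i | i <- w])%:R).
Proof. by rewrite -Ex_tuple. Qed.

(* [s] lists the items of a perfect packing: drawing from F is drawing
   uniformly from [s]. *)
Definition uniform_on (F : discrete_dist) (s : seq rat) :=
  [/\ forall x, x \in s -> 0 <= x, \sum_(x <- s) x = 1,
      forall f : rat -> rat, \sum_i iprob i * f (isize (d := F) i) = mean s f
    & forall i : 'I_(nitems F), isize i \in s].

(** The list repeats each size [b i] times. As the probabilities sum to 1, [alpha] is the reciprocal
    of its length. *)
Lemma P1_uniform F : P1 F -> exists s, uniform_on F s.
Proof.
move=> [alpha [b [alpha0 pack pb]]].
pose s := flatten [seq nseq (b i) (isize i) | i <- index_enum 'I_(nitems F)].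
have sumE (f : rat -> rat) : \sum_(x <- s) f x = \sum_i (b i)%:R * f (isize i).
  rewrite /s big_flatten big_map; apply: eq_bigr => i _.
  by rewrite big_nseq iter_addr_0 mulr_natl.
have b0 i : (0 < b i)%N.
  by have := iprob_gt0 i; rewrite pb pmulr_rgt0// ltr0n.
have ins (i : 'I_(nitems F)) : isize i \in s.
  apply/flatten_mapP; exists i; first exact: mem_index_enum.
  by rewrite mem_nseq b0 eqxx.
have sz : (size s)%:R = \sum_i (b i)%:R :> rat.
  have := sumE (fun=> 1); rewrite big_const_seq count_predT iter_addr_0 => ->.
  by apply: eq_bigr => i _; rewrite mulr1.
have asz : alpha * (size s)%:R = 1.
  by rewrite sz mulr_sumr -[RHS](iprob_sum1 F); apply: eq_bigr => i _; rewrite pb.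
exists s; split=> //.
- move=> x /flatten_mapP[i _]; rewrite mem_nseq => /andP[_ /eqP->].
  by have /andP[] := isize_range i.
- by rewrite (sumE id).
- move=> f; rewrite /mean sumE mulr_suml; apply: eq_bigr => i _.
  have s0 : (size s)%:R != 0 :> rat.
    by apply/eqP => s0; move: asz; rewrite s0 mulr0 => /eqP; rewrite eq_sym oner_eq0.
  rewrite pb -[LHS](mulfK s0).
  rewrite (_ : alpha * _ * _ * _ = (b i)%:R * f (isize i) * (alpha * (size s)%:R));
    last by ring.
  by rewrite asz mulr1.
Qed.

(** * Expected number of bins covered by DNF *)

Section DNF.
Variables (F : discrete_dist) (s : seq rat).
Hypothesis Fs : uniform_on F s.

Let s_ge0 x : x \in s -> 0 <= x. Proof. by case: Fs => + _ _ _; apply. Qed.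
Let s_gt0 : (0 < size s)%N.
Proof.
case: Fs => _ + _ _; case: s => // /esym/eqP.
by rewrite big_nil oner_eq0.
Qed.

Let p_ge0 i : 0 <= iprob (d := F) i. Proof. exact/ltW/iprob_gt0. Qed.

(** The state of the open bin is the amount r it still lacks, to match the target of
    [trunc_time]. *)
Let D n (r : rat) :=
  Ex (@iprob F) n (fun w => (DNF_from (1 - r) [seq isize i | i <- w])%:R).

Let DS n r : D n.+1 r =
  mean s (fun x => if r - x <= 0 then 1 + D n 1 else D n (r - x)).
Proof.
case: Fs => _ _ <- _; rewrite {1}/D ExS; apply: eq_bigr => i _; congr (_ * _).
pose tl l w := DNF_from l [seq isize (d := F) i | i <- w].
rewrite -[LHS]/(Ex _ n (fun w => (if 1 <= 1 - r + isize i then (tl 0 w).+1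
  else tl (1 - r + isize i) w)%:R)).
rewrite (_ : (1 <= 1 - r + isize i) = (r - isize i <= 0)); last by apply/idP/idP; lra.
case: ifP => _.
  rewrite -[X in X + _](Ex_cst (iprob_sum1 F) n) -ExD; apply: eq_Ex => w _.
  by rewrite subrr nat1r.
by apply: eq_Ex => w _; rewrite opprB addrA addrAC.
Qed.

(** A potential argument over the first draw: [trunc_time s n r] draws pay for the open bin, and H
    draws charged to each covered bin pay for its successor. The subtracted H is the charge of the
    first bin. *)
Lemma expected_DNF_ge H n :
  (forall M, trunc_time s M 1 <= H) -> n%:R - H <= H * expected DNF F n.
Proof.
move=> HM; rewrite expectedE.
suff DH r : 0 < r -> n%:R - trunc_time s n r <= H * D n r.
  have := DH 1 ltr01; rewrite /D subrr; apply: le_trans.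
  by rewrite lerD2l lerN2.
elim: n r => [|n IH] r r0.
  by rewrite /trunc_time big_ord0 subrr /D/= mulr0.
rewrite trunc_timeS r0 DS -meanZ -natr1 opprD addrA addrK.
rewrite -[n%:R](mean_cst _ s_gt0) -mulN1r -meanZ -meanD.
apply: ler_mean => x xs; rewrite mulN1r; case: ifP => rx; last first.
  by apply: IH; rewrite ltNge rx.
rewrite trunc_time_npos//; have := IH 1 ltr01; have := HM n; lra.
Qed.

(** The converse potential argument. Truncation at a fixed M only shortens the filling time, and the
    potential [H - trunc_time s M r] is what has been paid into the open bin. *)
Lemma expected_DNF_le M n :
  trunc_time s M 1 * expected DNF F n <= n%:R.
Proof.
rewrite expectedE; set H := trunc_time s M 1.
have le_trunc r r' : r <= r' -> trunc_time s M r <= trunc_time s M r'.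
  by move=> rr'; apply: ler_sum => t _; apply: ler_below.
suff DH r : 0 < r <= 1 -> H * D n r <= n%:R + H - trunc_time s M r.
  by have := DH 1; rewrite ltr01 lexx addrK /D subrr; apply.
elim: n r => [|n IH] r /andP[r0 r1].
  by rewrite /D/= mulr0 add0r subr_ge0 le_trunc.
rewrite DS -meanZ.
have : trunc_time s M r <= 1 + mean s (fun x => trunc_time s M (r - x)).
  apply: (@le_trans _ _ (trunc_time s M.+1 r)); last by rewrite trunc_timeS r0.
  by rewrite /trunc_time big_ord_recr/= lerDl below_ge0.
suff le_mean : mean s (fun x => H * (if r - x <= 0 then 1 + D n 1 else D n (r - x)))
    <= mean s (fun x => n%:R + H + - 1 * trunc_time s M (r - x)).
  move=> tr; apply: le_trans le_mean _.
  by rewrite meanD mean_cst// meanZ -natr1; lra.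
apply: ler_mean => x xs; have x0 := s_ge0 xs; case: ifP => rx.
  rewrite trunc_time_npos// mulr0 addr0 mulrDr mulr1 addrC lerD2r.
  by have := IH 1; rewrite ltr01 lexx addrK; apply.
rewrite mulN1r; apply: IH; rewrite ltNge rx/=; lra.
Qed.

End DNF.

(** * Bounds on the optimum *)

Lemma OPT_le_sum (L : seq rat) : (forall x, x \in L -> 0 <= x) ->
  (OPT L)%:R <= \sum_(x <- L) x.
Proof.
move=> L0; have Li0 (i : 'I_(size L)) : 0 <= L`_i by apply: L0; rewrite mem_nth.
rewrite /OPT; elim/big_ind: _.
- by rewrite big_seq sumr_ge0.
- by move=> a b; case: (leqP a b).
move=> P /andP[tP /forall_inP cP].
apply: (@le_trans _ _ (\sum_(B in P) \sum_(i in B) L`_i)).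
  rewrite -sum1_card natr_sum; exact: ler_sum.
rewrite -finset.big_trivIset// (big_nth 0) big_mkord.
rewrite [leRHS](bigID (mem (finset.cover P)))/= lerDl sumr_ge0//.
Qed.

(** The classes of the colours below k form a covering family. Their totals make them non-empty, so
    distinct colours give distinct sets. *)
Lemma OPT_ge_coloring (L : seq rat) (k : nat) (g : nat -> nat) :
  (forall c, (c < k)%N -> 1 <= \sum_(i < size L | g i == c) L`_i) ->
  (k <= OPT L)%N.
Proof.
move=> gk; pose cls (c : 'I_k) := [set i : 'I_(size L) | g i == c :> nat]%SET.
have cls1 c : 1 <= \sum_(i in cls c) L`_i.
  by under eq_bigl do rewrite inE; apply: gk.
have cls0 c : cls c != finset.set0.
  by apply/eqP => c0; have := cls1 c; rewrite c0 big_set0 ler10.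
have clsI c d : cls c :&: cls d != finset.set0 -> c = d.
  by case/set0Pn => i; rewrite !inE => /andP[/eqP-> /eqP]/val_inj.
have cls_inj : injective cls.
  by move=> c d cd; apply: clsI; rewrite -cd finset.setIid.
pose P := [set cls c | c : 'I_k]%SET.
have -> : k = #|P| by rewrite card_imset// card_ord.
apply: (@leq_bigmax_cond _ _ (fun P : {set {set _}} => #|P|)).
apply/andP; split; last first.
  by apply/forall_inP => B /imsetP[c _ ->].
apply/finset.trivIsetP => _ _ /imsetP[c _ ->] /imsetP[d _ ->] cd.
rewrite -finset.setI_eq0; apply: contraNT cd => /clsI ->; exact: eqxx.
Qed.

Lemma OPT_gt0 (L : seq rat) : 1 <= \sum_(x <- L) x -> (0 < OPT L)%N.
Proof.
move=> L1; apply: (@OPT_ge_coloring _ _ (fun=> 0%N)) => c; rewrite ltnS leqn0 => /eqP->.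
by move: L1; rewrite (big_nth 0) big_mkord.
Qed.

(** * Rapidly decreasing item sizes *)

Lemma nth_occurrence (T : eqType) (x0 x : T) (w : seq T) c :
  (c < count_mem x w)%N ->
  exists p, [/\ (p < size w)%N, nth x0 w p = x & count_mem x (take p w) = c].
Proof.
elim: w c => //= y w IH c; case: eqVneq => [->|yx] /=.
  case: c => [|c]; first by exists 0%N.
  by rewrite ltnS => /IH[p [pw px pc]]; exists p.+1; rewrite /= eqxx pc.
by rewrite add0n => /IH[p [pw px pc]]; exists p.+1; rewrite /= (negPf yx) pc.
Qed.

(** Colour each position by the number of earlier occurrences of its letter: every colour below k
    then receives each letter once. *)
Lemma OPT_ge_count m (h : 'I_m -> rat) (w : seq 'I_m) k : (0 < m)%N ->
  (forall i, 0 <= h i) -> 1 <= \sum_i h i ->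
  (forall i, (k <= count_mem i w)%N) -> (k <= OPT [seq h i | i <- w])%N.
Proof.
case: m h w => // m h w _ h0 h1 kw.
pose x0 : 'I_m.+1 := ord0.
apply: (@OPT_ge_coloring _ _ (fun p => count_mem (nth x0 w p) (take p w))) => c ck.
apply: le_trans h1 _.
rewrite -(big_mkord (fun p => count_mem (nth x0 w p) (take p w) == c)
  (fun p => [seq h i | i <- w]`_p)) size_map big_mkord.
rewrite (partition_big (fun p : 'I_(size w) => nth x0 w p) xpredT)//=.
apply: ler_sum => i _.
have [p [pw pi pc]] := nth_occurrence x0 (leq_trans ck (kw i)).
rewrite (bigD1 (Ordinal pw))/=; last by rewrite pi pc !eqxx.
rewrite (nth_map x0)// pi lerDl sumr_ge0// => q _.
by rewrite (nth_map x0).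
Qed.

Lemma below_Ex F s t r : uniform_on F s ->
  below s t r =
  Ex (@iprob F) t (fun w => (\sum_(i <- w) isize i < r)%R%:R).
Proof.
move=> Fs; elim: t r => [|t IH] r /=; first by rewrite big_nil.
case: Fs => _ _ <- _; apply: eq_bigr => i _; congr (_ * _).
by rewrite IH; apply: eq_Ex => w _; rewrite big_cons ltrBrDl.
Qed.

Lemma sum_count (T : finType) (f : T -> rat) (w : seq T) :
  \sum_(i <- w) f i = \sum_i (count_mem i w)%:R * f i.
Proof.
elim: w => [|x w IH]; first by rewrite big_nil big1// => i _; rewrite mul0r.
rewrite big_cons IH [RHS](eq_bigr (fun i => (x == i)%:R * f i + (count_mem i w)%:R * f i)).
  rewrite big_split/=; congr (_ + _); rewrite (bigD1 x)//= eqxx mul1r big1 ?addr0// => i ix.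
  by rewrite eq_sym (negPf ix) mul0r.
by move=> i _; rewrite /= natrD mulrDl.
Qed.

Lemma card_ord_lt B n : (n <= B)%N -> #|[set i : 'I_B | (i < n)%N]%SET| = n.
Proof.
by move=> nB; rewrite -sum1dep_card -(big_ord_widen B (fun=> 1%N) nB) sum1_card card_ord.
Qed.

Section GeometricInstance.
Variables (b M : nat).
Let B := b.+1.
Let Z : rat := \sum_(i < B) M.+1%:R ^+ (b - i).

(** The ratio M + 1 makes any M items of types beyond j smaller in total than one item of type j. *)
Definition geo_size (i : 'I_B) : rat := M.+1%:R ^+ (b - i) / Z.

Let Z_gt0 : 0 < Z.
Proof.
rewrite /Z big_ord_recl ltr_wpDr ?exprn_gt0 ?ltr0n//.
by apply: sumr_ge0 => i _; rewrite exprn_ge0.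
Qed.

Lemma geo_size_gt0 i : 0 < geo_size i.
Proof. by rewrite divr_gt0 ?exprn_gt0 ?ltr0n. Qed.

Lemma geo_size_sum : \sum_i geo_size i = 1.
Proof. by rewrite -mulr_suml divff// gt_eqF. Qed.

Lemma geo_size_decr (i j : 'I_B) : (j < i)%N ->
  geo_size i * M.+1%:R <= geo_size j.
Proof.
move=> ji; rewrite /geo_size mulrAC ler_wpM2r ?invr_ge0 ?(ltW Z_gt0)// -exprSr.
rewrite ler_weXn2l ?ler1n//.
have ib : (i <= b)%N by rewrite -ltnS ltn_ord.
exact: ltn_sub2l (leq_trans ji ib) ji.
Qed.

Fact geo_size_range i : 0 <= geo_size i <= 1.
Proof.
rewrite ltW ?geo_size_gt0//= -geo_size_sum (bigD1 i)//= lerDl.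
by apply: sumr_ge0 => j _; rewrite ltW// geo_size_gt0.
Qed.

Fact geo_prob_gt0 (i : 'I_B) : 0 < B%:R^-1 :> rat.
Proof. by rewrite invr_gt0 ltr0n. Qed.

Fact geo_prob_sum1 : \sum_(i < B) B%:R^-1 = 1 :> rat.
Proof. by rewrite sumr_const card_ord -[LHS]mulr_natl divff ?pnatr_eq0. Qed.

Definition geo_dist : discrete_dist :=
  DiscreteDist geo_size_range geo_prob_gt0 geo_prob_sum1.

Lemma geo_dist_P1 : P1 geo_dist.
Proof.
exists B%:R^-1, (fun=> 1%N); split; first exact: geo_prob_gt0 ord0.
  by rewrite /perfect_packing -[RHS]geo_size_sum; apply: eq_bigr => i _; rewrite mul1r.
by move=> i; rewrite mulr1.
Qed.

Let p : 'I_B -> rat := @iprob geo_dist.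

(** Types above j are unrestricted. The set of all types below j gives the disjoint events; general
    A arise because drawing a member of A leaves the event for the remaining set. *)
Definition seen_once (j : 'I_B) (A : {set 'I_B}) (w : seq 'I_B) : bool :=
  [forall (i : 'I_B | (i <= j)%N), count_mem i w == (i \in A)].

(** Each type before j counts once, and the at most M later items total less than the missing item
    j. *)
Lemma seen_once_lt1 (j : 'I_B) w : (size w <= M)%N ->
  seen_once j [set i : 'I_B | (i < j)%N]%SET w -> \sum_(i <- w) geo_size i < 1.
Proof.
move=> wM /forall_inP jw.
have szw : (size w)%:R = \sum_i (count_mem i w)%:R :> rat.
  have := sum_count (fun=> 1) w; rewrite big_const_seq count_predT iter_addr_0 => ->.
  by apply: eq_bigr => i _; rewrite mulr1.
have M0 : 0 < M.+1%:R :> rat by rewrite ltr0n.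
have sj0 := geo_size_gt0 j.
rewrite sum_count.
apply: (@le_lt_trans _ _ (\sum_(i < B | (i < j)%N) geo_size i +
    (size w)%:R * (geo_size j / M.+1%:R))).
  rewrite szw mulr_suml [X in _ <= X + _]big_mkcond -big_split/=; apply: ler_sum => i _.
  have C0 : 0 <= (count_mem i w)%:R * (geo_size j / M.+1%:R).
    by rewrite mulr_ge0// divr_ge0// ltW.
  case: (ltngtP i j) => ij.
  - rewrite (eqP (jw _ (ltnW ij))) inE ij in C0 *.
    by rewrite mul1r lerDl.
  - by rewrite add0r ler_wpM2l// ler_pdivlMr// geo_size_decr.
  - have /eqP -> : count_mem i w == (i \in [set i : 'I_B | (i < j)%N]%SET) by rewrite jw// ij.
    by rewrite inE ij ltnn !mul0r addr0.
apply: (@lt_le_trans _ _ (\sum_(i < B | (i < j)%N) geo_size i + geo_size j)).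
  rewrite ltrD2l mulrA ltr_pdivrMr// mulrC ltr_pM2l//.
  by rewrite ltr_nat ltnS.
rewrite -geo_size_sum [leRHS](bigID (fun i : 'I_B => (i < j)%N))/= lerD2l.
rewrite (bigD1 j)/= ?ltnn// lerDl.
by apply: sumr_ge0 => i _; rewrite ltW// geo_size_gt0.
Qed.

(** For j1 < j2, the event of j2 needs type j1 to be drawn and the event of j1 forbids it. *)
Lemma seen_once_disjoint w :
  \sum_(j < B) (seen_once j [set i : 'I_B | (i < j)%N]%SET w)%:R <= 1 :> rat.
Proof.
have [j wj|none] := pickP (fun j : 'I_B =>
  seen_once j [set i : 'I_B | (i < j)%N]%SET w); last first.
  by rewrite big1// => j _; rewrite none.
rewrite (bigD1 j)//= wj big1 ?addr0// => k kj.
suff excl (j1 j2 : 'I_B) : (j1 < j2)%N -> seen_once j1 [set i : 'I_B | (i < j1)%N]%SET w ->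
    seen_once j2 [set i : 'I_B | (i < j2)%N]%SET w -> False.
  case: (boolP (seen_once k _ w)) => // wk; exfalso.
  case: (ltngtP k j) => [kj'|jk|/val_inj kj']; last by rewrite kj' eqxx in kj.
    exact: excl kj' wk wj.
  exact: excl jk wj wk.
move=> j12 /forall_inP /(_ j1 (leqnn _)) /eqP c1 /forall_inP /(_ j1 (ltnW j12)).
by rewrite c1 !inE ltnn j12.
Qed.

Lemma seen_once_cons (j : 'I_B) (A : {set 'I_B}) i w :
  (forall k, k \in A -> (k < j)%N) ->
  seen_once j A (i :: w) =
    if i \in A then seen_once j (A :\ i)%SET w
    else (j < i)%N && seen_once j A w.
Proof.
move=> Aj; case: ifP => iA.
  apply: eq_forallb => k; case: (k <= j)%N => //=; rewrite !inE (eq_sym k).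
  case: (eqVneq i k) => [<-|_]; rewrite ?add0n//= iA.
  by case: (count_mem i w) => [|[]].
case: (ltnP j i) => ij /=.
  apply: eq_forallb => k; case: (leqP k j) => //= kj.
  by case: (eqVneq i k) => [ik|_]; rewrite ?add0n//; move: kj; rewrite -ik leqNgt ij.
by apply/negbTE/forall_inPn; exists i; rewrite //= eqxx iA add1n.
Qed.

(** The expected total duration of the event with a types to be seen, as the solution of the
    first-draw recurrence [GE]. *)
Let G (j : 'I_B) (a : nat) : rat := B%:R * a`!%:R / j.+1%:R ^+ a.+1.

(** The first draw keeps the event possible with probability (a + b - j)/B, at most 1 - 1/B since a
    <= j. Hence the truncation error shrinks by that factor per step. *)
Lemma seen_once_sum_ge (j : 'I_B) t (A : {set 'I_B}) :
  (forall k, k \in A -> (k < j)%N) ->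
  G j #|A| - B%:R * (1 - B%:R^-1) ^+ t <=
    \sum_(t' < t) Ex p t' (fun w => (seen_once j A w)%:R).
Proof.
have B0 : 0 < B%:R :> rat by rewrite ltr0n.
have card_lt (A' : {set 'I_B}) : (forall k, k \in A' -> (k < j)%N) -> (#|A'| <= j)%N.
  move=> A'j; rewrite -[leqRHS](card_ord_lt (ltnW (ltn_ord j))).
  by apply: subset_leq_card; apply/fintype.subsetP => k /A'j; rewrite inE.
elim: t A => [|t IH] A Aj.
  rewrite big_ord0 expr0 mulr1 subr_le0 /G -mulrA ler_piMr ?(ltW B0)//.
  rewrite ler_pdivrMr ?exprn_gt0 ?ltr0n// mul1r -natrX ler_nat.
  have := card_lt _ Aj; move: #|A| => a aj.
  elim: a aj => [|a IHa] aj; first by rewrite fact0 expn1.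
  rewrite factS expnS leq_mul//; [lia|apply: IHa; lia].
have qe : 0 <= (1 - B%:R^-1) ^+ t :> rat.
  by rewrite exprn_ge0// subr_ge0 invf_le1// ler1n.
pose u A := \sum_(t' < t) Ex p t' (fun w => (seen_once j A w)%:R).
have uS : \sum_(t' < t.+1) Ex p t' (fun w => (seen_once j A w)%:R) =
    (A == finset.set0)%:R + \sum_(i in A) B%:R^-1 * u (A :\ i)%SET +
    \sum_(i < B | (j < i)%N) B%:R^-1 * u A.
  rewrite big_ord_recl -addrA; congr (_ + _).
    rewrite /=; congr (nat_of_bool _)%:R; apply/forall_inP/eqP => [H|-> k _]; last by rewrite inE.
    apply/setP => k; rewrite inE; apply/negbTE/negP => kA.
    by have := H k (ltnW (Aj k kA)); rewrite kA.
  rewrite (eq_bigr (fun t' : 'I_t =>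
    \sum_i p i * Ex p t' (fun w => (seen_once j A (i :: w))%:R)))//.
  rewrite exchange_big/= (bigID (mem A))/=; congr (_ + _).
    apply: eq_bigr => i iA; rewrite mulr_sumr; apply: eq_bigr => t' _; congr (_ * _).
    by apply: eq_Ex => w _; rewrite seen_once_cons// iA.
  rewrite (bigID (fun i : 'I_B => (j < i)%N))/= [X in _ + X]big1 ?addr0; last first.
    move=> i /andP[iA ji]; apply: big1 => t' _.
    rewrite (@eq_Ex _ _ _ _ (fun=> 0)) ?Ex_cst ?mulr0//; first exact: geo_prob_sum1.
    by move=> w _; rewrite seen_once_cons// (negPf iA) (negPf ji).
  apply: eq_big => [i|i /andP[iA ji]].
    rewrite andbC; case: (boolP (j < i)%N) => //= ji; apply/negP => /Aj; lia.
  rewrite mulr_sumr; apply: eq_bigr => t' _; congr (_ * _).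
  by apply: eq_Ex => w _; rewrite seen_once_cons// (negPf iA) ji.
rewrite uS.
have cgt : #|[pred i : 'I_B | (j < i)%N]| = (b - j)%N.
  have := cardsC [set i : 'I_B | (i < j.+1)%N]%SET.
  rewrite card_ord (card_ord_lt (ltn_ord j)).
  rewrite (@eq_card _ (~: _)%SET [pred i : 'I_B | (j < i)%N]); last first.
    by move=> i; rewrite !inE -leqNgt.
  by move=> [<-]; rewrite addKn.
have aj := card_lt _ Aj; have jb : (j <= b)%N by rewrite -ltnS.
set a := #|A| in aj *; set q := 1 - B%:R^-1.
have Bi0 : 0 <= B%:R^-1 :> rat by rewrite invr_ge0 ltW.
have S1 : a%:R * (B%:R^-1 * (G j a.-1 - B%:R * q ^+ t)) <=
    \sum_(i in A) B%:R^-1 * u (A :\ i)%SET.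
  rewrite mulr_natl -sumr_const; apply: ler_sum => i iA; apply: ler_wpM2l => //.
  have -> : a.-1 = #|(A :\ i)%SET| by rewrite /a (cardsD1 i A) iA.
  by apply: IH => k; rewrite !inE => /andP[_ /Aj].
have -> : \sum_(i < B | (j < i)%N) B%:R^-1 * u A = (b - j)%:R * (B%:R^-1 * u A).
  by rewrite -cgt mulr_natl -sumr_const; apply: eq_bigl => i; rewrite inE.
have S2 : (b - j)%:R * (B%:R^-1 * (G j a - B%:R * q ^+ t)) <=
    (b - j)%:R * (B%:R^-1 * u A).
  by rewrite ler_wpM2l// ler_wpM2l// IH.
have GE : G j a = (A == finset.set0)%:R + a%:R * (B%:R^-1 * G j a.-1) +
    (b - j)%:R * (B%:R^-1 * G j a).
  have J0 : j%:R + 1 != 0 :> rat by rewrite natr1 pnatr_eq0.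
  have B1 : b%:R + 1 != 0 :> rat by rewrite natr1 pnatr_eq0.
  rewrite -cards_eq0 -/a natrB// /G /B; case: (a) => [|c].
    by rewrite eqxx /= fact0 expr1 -!natr1; field; rewrite J0.
  rewrite factS natrM [_ ^+ c.+2]exprS /= -!natr1.
  have : (j%:R + 1) ^+ c.+1 != 0 :> rat by rewrite expf_neq0.
  set P := _ ^+ c.+1 => P0.
  by field; rewrite P0 J0.
have qt : (a + (b - j))%:R * q ^+ t <= B%:R * q ^+ t.+1.
  rewrite exprS mulrA (_ : B%:R * q = b%:R).
    by rewrite ler_wpM2r// ler_nat; lia.
  by rewrite /q mulrBr mulr1 divff ?gt_eqF// /B -natr1 addrK.
have BqE c : c%:R * (B%:R^-1 * (B%:R * q ^+ t)) = c%:R * q ^+ t :> rat.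
  by rewrite mulKf ?gt_eqF.
rewrite {1}GE; move: S1 S2 qt; rewrite natrD !mulrBr mulrDl !BqE; lra.
Qed.

Lemma geo_trunc_time_ge s : uniform_on geo_dist s ->
  B%:R * (\sum_(j < B) j`!%:R / j.+1%:R ^+ j.+1 - B%:R * (1 - B%:R^-1) ^+ M) <=
    trunc_time s M 1.
Proof.
move=> Fs.
apply: (@le_trans _ _ (\sum_(t < M) Ex p t (fun w =>
    \sum_(j < B) (seen_once j [set i : 'I_B | (i < j)%N]%SET w)%:R))); last first.
  apply: ler_sum => t _; rewrite (below_Ex _ _ Fs).
  apply: ler_Ex => [i|w sw]; first exact: ltW (geo_prob_gt0 i).
  case: (boolP (_ < _)) => [_|wge1]; first exact: seen_once_disjoint.
  rewrite big1// => j _; case: (boolP (seen_once _ _ _)) => //.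
  move/seen_once_lt1; rewrite sw (ltnW (ltn_ord t)) => /(_ isT) w1.
  by move: wge1; rewrite /= w1.
under [leRHS]eq_bigr => t _ do rewrite (Ex_sum geo_prob_sum1).
rewrite exchange_big/=.
apply: (@le_trans _ _ (\sum_(j < B) (G j j - B%:R * (1 - B%:R^-1) ^+ M))); last first.
  apply: ler_sum => j _.
  rewrite -[X in G j X](card_ord_lt (ltnW (ltn_ord j))).
  by apply: seen_once_sum_ge => k; rewrite inE.
rewrite big_split/= sumr_const card_ord -[(- _) *+ _]mulr_natl.
have -> : \sum_(j < B) G j j = B%:R * \sum_(j < B) j`!%:R / j.+1%:R ^+ j.+1.
  by rewrite mulr_sumr; apply: eq_bigr => j _; rewrite mulrA.
by rewrite -mulrDr.
Qed.

(** The optimum is at least the smallest count. Bounding |d| by l/2 + d^2/(2l) leaves only second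
    moments to be computed. *)
Lemma geo_OPT_ge (w : seq 'I_B) (c l : rat) : 0 < l ->
  c - \sum_(i < B) ((l / 2) + (2 * l)^-1 * ((count_mem i w)%:R - c) ^+ 2) <=
    (OPT [seq geo_size i | i <- w])%:R.
Proof.
move=> l0.
have [i0 _ imin] := @arg_minnP _ (ord0 : 'I_B) xpredT (fun i => count_mem i w) isT.
have term i : `|(count_mem i w)%:R - c| <=
    l / 2 + (2 * l)^-1 * ((count_mem i w)%:R - c) ^+ 2.
  set d := _ - c; rewrite -(real_normK (num_real d)).
  rewrite -subr_ge0 (_ : _ - _ = (2 * l)^-1 * (`|d| - l) ^+ 2).
    by rewrite mulr_ge0 ?sqr_ge0// invr_ge0; lra.
  by field; rewrite gt_eqF.
have sum_ge : `|(count_mem i0 w)%:R - c| <=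
    \sum_(i < B) ((l / 2) + (2 * l)^-1 * ((count_mem i w)%:R - c) ^+ 2).
  rewrite (bigD1 i0)//= (le_trans (term i0))// lerDl sumr_ge0// => i _.
  exact: le_trans (normr_ge0 _) (term i).
have : (count_mem i0 w)%:R <= (OPT [seq geo_size i | i <- w])%:R :> rat.
  rewrite ler_nat; apply: OPT_ge_count => // [i| |i]; last exact: imin.
    exact/ltW/geo_size_gt0.
  by rewrite geo_size_sum.
by have := ler_norm (c - (count_mem i0 w)%:R); rewrite distrC; lra.
Qed.

Lemma geo_expected_OPT_ge (l : rat) n : 0 < l ->
  n%:R / B%:R - B%:R * (l / 2 + (2 * l)^-1 * n%:R) <= expected OPT geo_dist n.
Proof.
move=> l0; rewrite expectedE; set c := n%:R / B%:R.
have B0 : 0 < B%:R :> rat by rewrite ltr0n.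
have l2 : 0 <= (2 * l)^-1 by rewrite invr_ge0; lra.
have p0 i : 0 <= p i by exact: ltW (geo_prob_gt0 i).
apply: le_trans (ler_Ex p0 (fun w _ => geo_OPT_ge w c l0)).
rewrite (Ex_subl geo_prob_sum1) lerD2l lerN2.
rewrite (Ex_sum geo_prob_sum1).
have -> : B%:R * (l / 2 + (2 * l)^-1 * n%:R) = \sum_(i < B) (l / 2 + (2 * l)^-1 * n%:R).
  by rewrite sumr_const card_ord -[RHS]mulr_natl.
apply: ler_sum => i _.
rewrite ExD (Ex_cst geo_prob_sum1) lerD2l ExZ ler_wpM2l//.
pose h (k : 'I_B) : rat := (k == i)%:R - B%:R^-1.
have hi : \sum_k p k * (k == i)%:R = B%:R^-1.
  by rewrite (bigD1 i)//= eqxx mulr1 big1 ?addr0// => k /negPf ->; rewrite mulr0.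
have h0 : \sum_k p k * h k = 0.
  under eq_bigr do rewrite mulrBr.
  rewrite big_split/= hi sumrN -mulr_suml geo_prob_sum1 mul1r subrr//.
have := @Ex_sqr _ p geo_prob_sum1 n h 0 h0; rewrite expr0n add0r /= => EE.
have -> : Ex p n (fun w => ((count_mem i w)%:R - c) ^+ 2) =
    Ex p n (fun w => (0 + \sum_(k <- w) h k) ^+ 2).
  apply: eq_Ex => w sw; congr (_ ^+ 2); rewrite add0r /h big_split/= sumrN.
  rewrite big_const_seq count_predT iter_addr_0 sw /c -[_^-1 *+ n]mulr_natl; congr (_ - _).
  by elim: w {sw} => [|k w IH]; rewrite ?big_nil ?big_cons//= natrD IH.
(* The crude bound n on the variance of a count suffices. *)
rewrite EE ler_piMr// -geo_prob_sum1; apply: ler_sum => k _.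
rewrite ler_piMr ?p0// /h; case: (k == i).
  by rewrite expr_le1 ?subr_ge0 ?invf_le1 ?ler1n// gerBl invr_ge0 ltW.
by rewrite sub0r sqrrN expr_le1 ?invr_ge0 ?(ltW B0)// invf_le1// ler1n.
Qed.

End GeometricInstance.

(** * Asymptotics *)

Lemma limn_einf_ge (R : realType) (v : nat -> \bar R) (y : \bar R) N :
  (forall n, (N <= n)%N -> (y <= v n)%E) -> (y <= limn_einf v)%E.
Proof.
move=> yv; rewrite limn_einf_lim; apply: lime_ge; first exact: is_cvg_einfs.
exists N => // n /= Nn; apply: le_ereal_inf_tmp => _ [k /= nk <-].
exact/yv/(leq_trans Nn).
Qed.

Lemma limn_einf_le (R : realType) (v : nat -> \bar R) (y : \bar R) N :
  (forall n, (N <= n)%N -> (v n <= y)%E) -> (limn_einf v <= y)%E.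
Proof.
move=> vy; rewrite limn_einf_lim; apply: lime_le; first exact: is_cvg_einfs.
exists N => // n /= Nn; apply: ge_ereal_inf; exists (v n); last exact: vy.
by exists n => /=.
Qed.

Lemma limn_einf_ratr_ge (R : realType) (u : nat -> rat) (a c : rat) N : 0 <= c ->
  (forall n, (N <= n)%N -> (0 < n)%N -> a - c / n%:R <= u n) ->
  ((ratr a)%:E <= limn_einf (fun n => (ratr (u n) : R)%:E))%E.
Proof.
move=> c0 au; apply/lee_subgt0Pr => e e0.
have [q] := rat_in_itvoo e0; rewrite in_itv/= => /andP[q0 qe].
rewrite ltr0q in q0.
apply: (@limn_einf_ge _ _ _ (maxn N (Num.bound (c / q)).+1)) => n.
rewrite geq_max => /andP[Nn cn].
have n0 : (0 < n)%N by apply: leq_trans cn.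
rewrite -EFinB lee_fin; apply: (@le_trans _ _ (ratr (a - q))).
  by rewrite rmorphB/= lerD2l lerN2 ltW.
rewrite ler_rat; apply: le_trans (au n Nn n0); rewrite lerD2l lerN2.
have := archi_boundP (_ : 0 <= c / q); rewrite divr_ge0 ?(ltW q0)// => /(_ isT) cb.
rewrite ler_pdivrMr ?ltr0n// mulrC -ler_pdivrMr//; apply: le_trans (ltW cb) _.
by rewrite ler_nat ltnW.
Qed.

Lemma Ex_ge_nseq m (p : 'I_m -> rat) n f i : (forall i, 0 <= p i) ->
  (forall w, 0 <= f w) -> p i ^+ n * f (nseq n i) <= Ex p n f.
Proof.
move=> p0; elim: n f => [|n IH] f f0; first by rewrite mul1r.
have Ex0 g : (forall w, 0 <= g w) -> 0 <= Ex p n g.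
  elim: n {IH} g => [|n IHn] g g0 /=; first exact: g0.
  by apply: sumr_ge0 => k _; rewrite mulr_ge0// IHn.
rewrite ExS (bigD1 i)//= exprS -mulrA; apply: (@le_trans _ _ (p i * Ex p n (fun w => f (i :: w)))).
  by rewrite ler_wpM2l// (IH (fun w => f (i :: w))).
by rewrite lerDl sumr_ge0// => k _; rewrite mulr_ge0// Ex0.
Qed.

Section Uniform.
Variables (F : discrete_dist) (s : seq rat).
Hypothesis Fs : uniform_on F s.

Let p_ge0 i : 0 <= iprob (d := F) i. Proof. exact/ltW/iprob_gt0. Qed.

Let sz_gt0 : 0 < (size s)%:R :> rat.
Proof.
case: Fs => _ s1 _ _; rewrite ltr0n lt0n; apply/eqP => /size0nil s0.
by move/eqP: s1; rewrite s0 big_nil eq_sym oner_eq0.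
Qed.

Let mean_size : \sum_i iprob i * isize (d := F) i = (size s)%:R^-1.
Proof. by case: Fs => _ s1 /(_ id) -> _; rewrite /mean s1 mul1r. Qed.

Lemma expected_OPT_le n : expected OPT F n <= n%:R / (size s)%:R.
Proof.
rewrite expectedE -mean_size -(Ex_sum_letters (iprob_sum1 F)).
apply: ler_Ex => // w _.
rewrite -(big_map (isize (d := F)) xpredT id); apply: OPT_le_sum => x /mapP[i _ ->].
by have /andP[] := isize_range i.
Qed.

(** A long constant word of an item of positive size covers a bin and has positive probability. *)
Lemma expected_OPT_gt0 : exists N, forall n, (N <= n)%N -> 0 < expected OPT F n.
Proof.
have [i i0] : exists i : 'I_(nitems F), 0 < isize i.
  apply: contrapT => /forallNP none.
  have := sz_gt0; rewrite -invr_gt0 -mean_size ltNge => /negP; apply.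
  apply: sumr_le0 => i _; rewrite mulr_ge0_le0// leNgt; exact/negP/none.
exists (Num.bound (isize i)^-1) => n Nn.
have ni : 1 <= n%:R * isize i.
  rewrite -ler_pdivrMr// mul1r.
  have := archi_boundP (_ : 0 <= (isize i)^-1); rewrite invr_ge0 ltW// => /(_ isT) /ltW.
  by move/le_trans; apply; rewrite ler_nat.
rewrite expectedE; apply: lt_le_trans (Ex_ge_nseq n i p_ge0 _) => //.
rewrite mulr_gt0 ?exprn_gt0 ?iprob_gt0// ltr0n; apply: OPT_gt0.
by rewrite big_map big_nseq iter_addr_0 -[_ *+ n]mulr_natl.
Qed.

Lemma expected_DNF_ge0 n : 0 <= expected DNF F n.
Proof.
rewrite expectedE -[X in X <= _](Ex_cst (iprob_sum1 F) n).
by apply: (ler_Ex p_ge0) => w _.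
Qed.

(** With b the length of s, E[DNF] >= n/(H b) - 1 and E[OPT] <= n/b give a ratio of at least 1/H -
    b/n. *)
Lemma AECR_DNF_ge (R : realType) (H : rat) : 0 < H ->
  (forall M, trunc_time s M 1 <= H * (size s)%:R) ->
  ((ratr H^-1)%:E <= AECR R DNF F)%E.
Proof.
move=> H0 HM; have [N OPT0] := expected_OPT_gt0.
apply: (@limn_einf_ratr_ge _ _ _ (size s)%:R N) => // n Nn n0.
have n0' : 0 < n%:R :> rat by rewrite ltr0n.
have := expected_DNF_ge Fs n HM; have := expected_DNF_ge0 n.
have := expected_OPT_le n; have := OPT0 n Nn.
set d := expected DNF F n; set o := expected OPT F n; set b : rat := (size s)%:R.
have b0 : 0 < b by exact: sz_gt0.
move=> o0 on d0 dn; rewrite ler_pdivlMr//.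
have a0 : 0 <= H^-1 by rewrite invr_ge0 ltW.
have [neg|pos] := lerP (H^-1 - b / n%:R) 0.
  by apply: le_trans d0; rewrite mulr_le0_ge0// ltW.
apply: (@le_trans _ _ ((H^-1 - b / n%:R) * (n%:R / b))).
  by rewrite ler_wpM2l// ltW.
rewrite (_ : _ * _ = (n%:R - H * b) / (H * b)); last by field; rewrite !gt_eqF.
by rewrite ler_pdivrMr ?mulr_gt0// [leRHS]mulrC.
Qed.

End Uniform.

(** * Upper bounds on the ratio from the geometric instances *)

Lemma geo_ratio_le b M (s : seq rat) (e : rat) : uniform_on (geo_dist b M) s -> 0 < e ->
  e * b.+1%:R < trunc_time s M 1 ->
  exists N, forall n, (N <= n)%N ->
    expected DNF (geo_dist b M) n / expected OPT (geo_dist b M) n <= e^-1.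
Proof.
move=> Fs e0; set B : rat := b.+1%:R; set H := trunc_time s M 1 => eH.
have B0 : 0 < B by rewrite ltr0n.
have H0 : 0 < H by apply: le_lt_trans eH; rewrite mulr_ge0// ltW.
pose th := 1 - e * B / H.
have th0 : 0 < th by rewrite subr_gt0 ltr_pdivrMr// mul1r.
exists (Num.bound (B ^+ 4 / th ^+ 2)).+1 => n bn.
have nb : B ^+ 4 / th ^+ 2 <= n%:R.
  have := archi_boundP (_ : 0 <= B ^+ 4 / th ^+ 2).
  rewrite divr_ge0 ?exprn_ge0 ?(ltW B0) ?(ltW th0)// => /(_ isT) /ltW /le_trans; apply.
  by rewrite ler_nat ltnW.
have n0 : 0 < n%:R :> rat by rewrite ltr0n; apply: leq_trans bn.
(* For l = B^2/th the loss in E[OPT] is B^3/(2 th) + n th/(2B), which is at most n th/B once n >=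
   B^4/th^2. *)
have l0 : 0 < B ^+ 2 / th by rewrite divr_gt0// exprn_gt0.
have := @geo_expected_OPT_ge b M _ n l0; have := expected_DNF_le Fs M n.
rewrite -/H -/B; set d := expected DNF _ n; set o := expected OPT _ n => dn on.
have no : n%:R * (1 - th) / B <= o.
  apply: le_trans on; rewrite -subr_ge0.
  rewrite (_ : _ - _ = th / (2 * B) * (n%:R - B ^+ 4 / th ^+ 2)).
    by rewrite mulr_ge0 ?subr_ge0// divr_ge0 ?(ltW th0)//; lra.
  by field; rewrite !gt_eqF.
have no' : n%:R * e <= o * H.
  rewrite -ler_pdivrMr//; apply: le_trans no; rewrite /th.
  by rewrite le_eqVlt; apply/orP; left; apply/eqP; field; rewrite !gt_eqF.
have o0 : 0 < o by rewrite -(pmulr_lgt0 _ H0); apply: lt_le_trans no'; rewrite mulr_gt0.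
rewrite ler_pdivrMr// ler_pdivlMl// -(ler_pM2l H0) mulrCA mulrC.
apply: le_trans (_ : n%:R * e <= _); first by rewrite ler_wpM2r// ltW.
by rewrite mulrC in no' *; rewrite (mulrC H).
Qed.

Lemma bernoulli_decay (x : rat) M : 0 <= x <= 1 ->
  (1 - x) ^+ M * (1 + M%:R * x) <= 1.
Proof.
move=> /andP[x0 x1]; elim: M => [|M IH]; first by rewrite mul0r addr0 mulr1.
rewrite exprSr -mulrA; apply: le_trans IH; rewrite ler_wpM2l ?exprn_ge0 ?subr_ge0//.
rewrite -natr1; have : 0 <= M%:R * x * x + x * x by rewrite addr_ge0 ?mulr_ge0.
by lra.
Qed.

Lemma geo_AECR_le (R : realType) b (e : rat) : 0 < e ->
  e < \sum_(j < b.+1) j`!%:R / j.+1%:R ^+ j.+1 ->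
  exists2 F, P1 F & (AECR R DNF F <= (ratr e)^-1%:E)%E.
Proof.
set c := \sum_(j < _) _ => e0 ec; set B : rat := b.+1%:R.
have B0 : 0 < B by rewrite ltr0n.
have Bi : 0 <= B^-1 <= 1 by rewrite invr_ge0 ltW//= invf_le1// ler1n.
pose eta := c - e.
have eta0 : 0 < eta by rewrite subr_gt0.
(* By [bernoulli_decay] the error B (1 - 1/B)^M is at most B/(1 + M/B), hence less than eta. *)
pose M := (Num.bound (B ^+ 2 / eta)).+1.
have MB : B ^+ 2 / eta < M%:R.
  have := archi_boundP (_ : 0 <= B ^+ 2 / eta).
  rewrite divr_ge0 ?exprn_ge0 ?(ltW B0) ?(ltW eta0)// => /(_ isT) /lt_trans; apply.
  by rewrite ltr_nat.
have qM : B * (1 - B^-1) ^+ M < eta.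
  have D0 : 0 < 1 + M%:R * B^-1 by rewrite ltr_wpDr// mulr_ge0//; case/andP: Bi.
  have := bernoulli_decay M Bi; rewrite -ler_pdivlMr// mul1r => q.
  apply: (@le_lt_trans _ _ (B * (1 + M%:R * B^-1)^-1)); first by rewrite ler_wpM2l// ltW.
  rewrite ltr_pdivrMr// mulrDr mulr1 ltr_wpDl ?(ltW eta0)//.
  by rewrite mulrA ltr_pdivlMr// [ltRHS]mulrC -ltr_pdivrMr//.
exists (geo_dist b M); first exact: geo_dist_P1.
have [s Fs] := P1_uniform (geo_dist_P1 b M).
have eH : e * B < trunc_time s M 1.
  apply: lt_le_trans (geo_trunc_time_ge Fs); rewrite -/B -/c mulrC ltr_pM2l//.
  by rewrite ltrBrDl -ltrBrDr.
have [N ratio] := geo_ratio_le Fs e0 eH.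
apply: (@limn_einf_le _ _ _ N) => n /ratio.
by rewrite lee_fin -fmorphV/= ler_rat.
Qed.

(** * Comparison of 29/20 with the series for big items *)

Lemma max_isize_ge F (c : rat) : 0 < c -> c <= max_isize F ->
  exists i : 'I_(nitems F), c <= isize i.
Proof.
move=> c0; rewrite /max_isize; elim/big_ind: _ => [|x y IHx IHy|i _ ci].
- by move=> /(lt_le_trans c0); rewrite ltxx.
- by rewrite le_max => /orP[/IHx|/IHy].
by exists i.
Qed.

(* By (1 + 1/(n+1))^(n+1) <= e <= 11/4; this lower bound telescopes. *)
Lemma big_item_term_ge (R : realType) (n : nat) :
  4 / 11 * ((n.+1%:R)^-1 - (n.+2%:R)^-1) <=
  1 / n.+2%:R ^+ 2 * (1 - 1 / n.+2%:R) ^+ n :> R.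
Proof.
have n1 : 0 < n.+1%:R :> R by rewrite ltr0n.
have n2 : 0 < n.+2%:R :> R by rewrite ltr0n.
set x : R := n.+1%:R in n1 *; have n2E : n.+2%:R = x + 1 :> R by rewrite natr1.
rewrite n2E in n2 *.
have exp_le : (1 + x^-1) ^+ n.+1 <= 11 / 4.
  apply: le_trans (expR1_le R).
  have -> : expR 1 = expR x^-1 ^+ n.+1 by rewrite -expRM_natl divff// gt_eqF.
  rewrite lerXn2r ?nnegrE ?expR_ge0 ?expR_ge1Dx//.
  by rewrite addr_ge0// invr_ge0 ltW.
have -> : 1 - 1 / (x + 1) = (1 + x^-1)^-1.
  by field; rewrite !gt_eqF.
rewrite exprVn; move: exp_le; rewrite exprSr.
have P0 : 0 < (1 + x^-1) ^+ n by rewrite exprn_gt0// ltr_wpDr// invr_ge0 ltW.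
set P := _ ^+ n in P0 * => PE.
rewrite -subr_ge0 (_ : _ - _ = 4 / 11 / ((x + 1) ^+ 2 * P) * (11 / 4 - P * (1 + x^-1))).
  have D0 : 0 < (x + 1) ^+ 2 * P by rewrite mulr_gt0// exprn_gt0.
  by rewrite mulr_ge0 ?subr_ge0// divr_ge0 ?(ltW D0)//; lra.
by field; rewrite !gt_eqF.
Qed.

(** The terms for i = 2, ..., 5 are exact; the later ones are bounded by the telescoping sum. *)
Lemma big_item_partial_sum_ge (R : realType) (m : nat) :
  1 / 4 + 2 / 27 + 9 / 256 + 64 / 3125 + 4 / 11 * (1 / 5 - (m + 5)%:R^-1) <=
  \sum_(2 <= i < m + 6) (1 / i%:R ^+ 2 * (1 - 1 / i%:R) ^+ (i - 2)) :> R.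
Proof.
elim: m => [|m IH].
  rewrite !add0n; do 4 rewrite big_nat_recr//=.
  by rewrite big_geq// !subSS !subn0 le_eqVlt; apply/orP; left; apply/eqP; field.
have m6 : (2 <= m + 6)%N by rewrite addnC.
rewrite addSn big_nat_recr ?m6//=.
have := big_item_term_ge R (m + 4).
have -> : (m + 4).+2 = (m + 6)%N by lia.
have -> : (m + 4).+1 = (m + 5)%N by lia.
have -> : (m + 6 - 2 = m + 4)%N by lia.
have -> : (m + 5).+1 = (m + 6)%N by lia.
by lra.
Qed.

Lemma big_item_series_ge (R : realType) :
  ((29 / 20 : R)%:E <= 1 + \sum_(2 <= i <oo)
     (1 / i%:R ^+ 2 * (1 - 1 / i%:R) ^+ (i - 2) : R)%:E)%E.
Proof.
(* The lower bounds tend to about 0.4524, so with 200 telescoped terms they already exceed 9/20. *)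
apply: (@le_trans _ _ (1 + \sum_(2 <= i < 200 + 6)
     (1 / i%:R ^+ 2 * (1 - 1 / i%:R) ^+ (i - 2) : R)%:E)%E).
  rewrite sumEFin -EFinD lee_fin.
  have := big_item_partial_sum_ge R 200.
  rewrite -[(200 + 5)%N]/205%N; lra.
rewrite leeD2l//; apply: nneseries_lim_ge => i i2 _.
rewrite lee_fin mulr_ge0 ?divr_ge0 ?exprn_ge0// subr_ge0 div1r invf_le1 ?ltr0n ?ler1n//; lia.
Qed.

(** * The bounds of the theorem *)

Lemma inf_AECR_ge (R : realType) :
  ((2 / 3 : R)%:E <= ereal_inf [set AECR R DNF F | F in P1])%E.
Proof.
apply: le_ereal_inf_tmp => _ [F FP1 <-]; have [s Fs] := P1_uniform FP1.
have h0 : 0 < 3 / 2 :> rat by lra.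
have := @AECR_DNF_ge _ _ Fs R _ h0.
rewrite (_ : ratr (3 / 2)^-1 = 2 / 3 :> R).
  apply => M; case: (Fs) => s0 s1 _ _; rewrite -{1}s1; exact: trunc_time_le R s M s0.
by rewrite invf_div rmorphM fmorphV/= !rmorph_nat.
Qed.

Lemma inf_AECR_le (R : realType) :
  (ereal_inf [set AECR R DNF F | F in P1] <=
     (\sum_(1 <= i <oo) ((i.-1)`!%:R / i%:R ^+ i : R)%:E)^-1)%E.
Proof.
have lower := inf_AECR_ge R.
set I := ereal_inf _ in lower *.
have I0 : (0 <= I)%E by apply: le_trans lower; rewrite lee_fin; lra.
have t0 i : (1 <= i)%N -> (0 <= ((i.-1)`!%:R / i%:R ^+ i : R)%:E)%E.
  by move=> _; rewrite lee_fin divr_ge0// exprn_ge0.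
(* Inversion reverses order, so it suffices that every partial sum is at most [I^-1]. Otherwise a
   rational q strictly between the two contradicts [geo_AECR_le]. *)
rewrite inve_pge ?inE//; last by apply: nneseries_ge0 => i i1 _; exact: t0.
apply: lime_le; first by apply: is_cvg_nneseries => i i1 _; exact: t0.
exists 2%N => // -[|b] //= _.
rewrite sumEFin big_add1 big_mkord /=.
case: b => [|b]; first by rewrite big_ord0 inve_ge0.
set c : rat := \sum_(j < b.+1) j`!%:R / j.+1%:R ^+ j.+1.
rewrite (_ : \sum_(j < b.+1) _ = ratr c :> R); last first.
  rewrite rmorph_sum/=; apply: eq_bigr => j _.
  by rewrite fmorph_div rmorphXn/= !ratr_nat.
rewrite leNgt; apply/negP => Ic.
have Ii0 : (0 <= I^-1)%E by rewrite inve_ge0.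
have [r rE] : exists r, I^-1%E = r%:E.
  by move: Ic Ii0; case: (I^-1)%E => // r; exists r.
rewrite rE lte_fin in Ic; rewrite rE lee_fin in Ii0.
have [q] := rat_in_itvoo Ic; rewrite in_itv/= => /andP[rq qc].
have q0 : 0 < q by rewrite -(ltr0q R); apply: le_lt_trans rq.
rewrite ltr_rat in qc.
have [F FP1 Fq] := @geo_AECR_le R b q q0 qc.
have Iq : (I <= (ratr q)^-1%:E)%E by apply: ge_ereal_inf; exists (AECR R DNF F) => //; exists F.
have qr0 : 0 < ratr q :> R by rewrite ltr0q.
have : ((ratr q)%:E <= I^-1)%E.
  rewrite inve_pge ?inE ?lee_fin ?(ltW qr0)//.
  by rewrite inver gt_eqF.
by rewrite rE lee_fin leNgt rq.
Qed.

Lemma AECR_big_item_ge (R : realType) (F : discrete_dist) :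
  P1 F -> 1 / 2 <= max_isize F ->
  ((1 + \sum_(2 <= i <oo)
     (1 / i%:R ^+ 2 * (1 - 1 / i%:R) ^+ (i - 2) : R)%:E)^-1 <= AECR R DNF F)%E.
Proof.
move=> FP1 Fmax; have [s Fs] := P1_uniform FP1.
have h0 : 0 < 29 / 20 :> rat by lra.
have := @AECR_DNF_ge _ _ Fs R _ h0.
have hr : ratr (29 / 20)^-1 = (29 / 20)^-1 :> R.
  by rewrite fmorphV rmorphM fmorphV/= !rmorph_nat.
rewrite hr => low.
apply: le_trans (low _); last first.
  have h2 : 0 < 1 / 2 :> rat by lra.
  have [i i2] := max_isize_ge h2 Fmax.
  case: (Fs) => s0 s1 _ /(_ i) si M; rewrite -{1}s1.
  by apply: (@trunc_time_le_big R s _ M s0 si); rewrite s1; lra.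
have S0 := big_item_series_ge R.
rewrite inve_ple ?inE.
- by rewrite inver invr_eq0 gt_eqF ?invrK//; lra.
- by apply: le_trans S0; rewrite lee_fin; lra.
- by rewrite lee_fin invr_ge0; lra.
Qed.

Local Open Scope ereal_scope.

Theorem theorem7 (R : realType) :
  ((2 / 3 : R)%:E <= ereal_inf [set AECR R DNF F | F in P1] /\
   ereal_inf [set AECR R DNF F | F in P1] <=
     (\sum_(1 <= i <oo) ((i.-1)`!%:R / i%:R ^+ i : R)%:E)^-1) /\
  (forall F : discrete_dist, P1 F -> (1 / 2 <= max_isize F)%R ->
     (1 + \sum_(2 <= i <oo)
            (1 / i%:R ^+ 2 * (1 - 1 / i%:R) ^+ (i - 2) : R)%:E)^-1
     <= AECR R DNF F).
Proof.
split; first by split; [exact: inf_AECR_ge | exact: inf_AECR_le].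
exact: AECR_big_item_ge.
Qed.
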